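(* Let $n\ge 49$ be an integer and suppose that $\mathcal{I}=(\mathcal{S},\mathcal{A})$ is a partial affine plane of order $n$ in which parallelism is an equivalence relation on $\mathcal{A}$. If $\mathcal{I}$ has more than $n^2-\sqrt n$ lines, or if $\mathcal{I}$ has at least $n^2-\sqrt{2n}+1$ lines and every point of $\mathcal{S}$ lies on at least one line of $\mathcal{A}$, then $\mathcal{I}$ can be extended to an affine plane of order $n$.
   Context: A partial affine plane of order $n$ ($n\ge 2$) is a pair $(\mathcal{S},\mathcal{A})$ where $\mathcal{S}$ is a set of $n^2$ points and $\mathcal{A}$ is a set of subsets of $\mathcal{S}$ (lines) such that each line has exactly $n$ points and any two distinct lines meet in at most one point. It can be extended (completed) to an affine plane if there is an affine plane $(\mathcal{S},\mathcal{A}')$ of order $n$ on the same point set with $\mathcal{A}\subseteq\mathcal{A}'$. Two lines are parallel if they coincide or have no point in common. *)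

(* Defs.v *)
From mathcomp Require Import all_boot.

Set Implicit Arguments.
Unset Strict Implicit.
Unset Printing Implicit Defensive.

(* The point set is a finite type T; a line is its set of points. *)
Record partial_affine_plane (T : finType) (n : nat) (A : {set {set T}}) : Prop :=
  PartialAffinePlane {
    pap_order : 2 <= n;
    pap_points : #|T| = n ^ 2;
    pap_line_size : forall l, l \in A -> #|l| = n;
    pap_meet : forall l m, l \in A -> m \in A -> l != m -> #|l :&: m| <= 1
  }.

(* The usual axioms (joining line, Playfair, a triangle), together with the
   order n being the number of points on each line. *)
Record affine_plane (T : finType) (n : nat) (A : {set {set T}}) : Prop :=
  AffinePlane {
    ap_order : 2 <= n;
    ap_line_size : forall l, l \in A -> #|l| = n;
    ap_join : forall x y, x != y ->
      exists! l : {set T}, [/\ l \in A, x \in l & y \in l];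
    ap_playfair : forall x l, l \in A -> x \notin l ->
      exists! m : {set T}, [/\ m \in A, x \in m & [disjoint l & m]];
    ap_triangle : exists x y z : T,
      [/\ x != y, x != z, y != z &
          forall l, l \in A -> ~~ [&& x \in l, y \in l & z \in l]]
  }.

Definition parallel (T : finType) (l m : {set T}) : bool :=
  (l == m) || [disjoint l & m].

Definition completable (T : finType) (n : nat) (A : {set {set T}}) : Prop :=
  exists2 A' : {set {set T}}, affine_plane n A' & A \subset A'.

(* Main.v *)
Require Import Defs.
From mathcomp Require Import all_boot all_order all_algebra.
From mathcomp Require Import zify.

Set Implicit Arguments.
Unset Strict Implicit.
Unset Printing Implicit Defensive.

(** Let b be the number of lines and s = n^2 - b.  If there were at least n + 2
    parallel classes, every point would have degree at most n.  A point of
    degree n together with the points not collinear with it is then a set of n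
    points that avoids all lines of two classes, whereas the points avoiding
    both classes number at most s^2; and when all points are covered, bounding
    the second moment of n - degree gives 2n <= s^2 + s.  Both are excluded.

    With at most n + 1 classes, one point at infinity per class and a line at
    infinity produce a partial projective plane of order n, which can be
    extended one line at a time (following Dow).  Let the deficiency e of a
    point be n + 1 minus its degree.  A point with e = 1 and the points not
    collinear with it form a new line.  If there is none, there is a point p
    with e = 2, and 2n points are not collinear with it; counting shows that
    collinearity between them is bipartite, and each half together with p is a
    new line. *)

(** * Splitting a dense graph into two independent sets *)

(* Here h will be collinearity between the points of N that are not collinear
   with a point of deficiency 2, and w x + 2 the deficiency of x. *)
Section TwoIndependentSets.
Variables (V : finType) (N : {set V}) (h : rel V) (w : V -> nat) (n k : nat).

Definition nbhd (x : V) : {set V} := [set y in N | h x y].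

Hypothesis h_sym : symmetric h.
Hypothesis h_irr : irreflexive h.
Hypothesis card_N : #|N| = 2 * n.
Hypothesis deg_h : {in N, forall x, #|nbhd x| + w x + 1 = n}.
Hypothesis tri_h : {in N &, forall x y, h x y ->
  #|nbhd x :&: nbhd y| <= (w x).+1 * (w y).+1}.
Hypothesis sum_w : \sum_(x in N) w x = 2 * k.
Hypothesis w_le : {in N, forall x, w x <= k}.
Hypothesis k_small : (k + 3) ^ 2 <= 2 * n.
Hypothesis n_large : 49 <= n.

Lemma nbhdP x y : (y \in nbhd x) = (y \in N) && h x y.
Proof. by rewrite inE. Qed.

Lemma sub_nbhd x : nbhd x \subset N.
Proof. by apply/subsetP => y; rewrite inE => /andP[]. Qed.

Lemma linear_k : 6 * k + 6 < n.
Proof. nia. Qed.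

Lemma leq_card_setU3 (A B C : {set V}) :
  #|A| + #|B| + #|C| <=
  #|A :|: B :|: C| + #|A :&: B| + #|A :&: C| + #|B :&: C|.
Proof.
have h1 := cardsUI (A :|: B) C; have h2 := cardsUI A B.
have h3 := cardsUI (A :&: C) (B :&: C).
rewrite -setIUl in h3; lia.
Qed.

Lemma triangle_weights x y z : x \in N -> y \in N -> z \in N ->
  h x y -> h x z -> h y z -> w z = 0 -> n + 3 <= (w x + 3) * (w y + 3).
Proof.
move=> xN yN zN xy xz yz wz.
have h1 := tri_h xN yN xy; have h2 := tri_h xN zN xz.
have h3 := tri_h yN zN yz.
have h4 := leq_card_setU3 (nbhd x) (nbhd y) (nbhd z).
have dx := deg_h xN; have dy := deg_h yN; have dz := deg_h zN.
have : #|nbhd x :|: nbhd y :|: nbhd z| <= #|N|.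
  by apply: subset_leq_card; rewrite !subUset !sub_nbhd.
rewrite card_N wz in h2 h3 dz *; nia.
Qed.

Definition light : {set V} := [set x | w x == 0].

Lemma card_heavy (A : {set V}) : A \subset N -> #|A :\: light| <= 2 * k.
Proof.
move=> AN; rewrite -sum_w -sum1_card.
rewrite [leqRHS](big_setID (A :\: light)) /=.
have -> : N :&: (A :\: light) = A :\: light.
  by apply/setIidPr; apply: subset_trans AN; apply: subsetDl.
apply: leq_trans (leq_addr _ _); apply: leq_sum => x.
by rewrite !inE lt0n => /andP[].
Qed.

Lemma exists_light (A : {set V}) : A \subset N -> 2 * k < #|A| ->
  exists2 x, x \in A & w x = 0.
Proof.
move=> AN kA; have := card_heavy AN; have := cardsID light A.
case: (set_0Vmem (A :&: light)) => [-> | [x]]; first by rewrite cards0; lia.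
by rewrite !inE => /andP[xA /eqP wx] _ _; exists x.
Qed.

Definition side (r : V) : {set V} :=
  [set z in N | [disjoint nbhd z & nbhd r :&: light]].

Lemma disjoint_nbhd q r : q \in N -> r \in N -> h q r -> w q = 0 -> w r = 0 ->
  nbhd q :&: nbhd r = set0.
Proof.
move=> qN rN qr wq wr.
apply/eqP/set0Pn => -[z]; rewrite !inE => /andP[/andP[zN qz] /andP[_ rz]].
have := triangle_weights zN qN rN; rewrite !(h_sym z) => /(_ qz rz qr wr).
have := w_le zN; have := linear_k; rewrite wq; lia.
Qed.

Lemma nbhd_sub_side r : r \in N -> w r = 0 -> nbhd r \subset side r.
Proof.
move=> rN wr; have kn := linear_k.
apply/subsetP => x; rewrite !inE => /andP[xN rx]; rewrite xN /=.
rewrite -setI_eq0; apply/set0Pn => -[y]; rewrite !inE.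
case/andP=> /andP[yN xy] /andP[/andP[_ ry] /eqP wy].
have := triangle_weights xN rN yN; rewrite h_sym in rx.
move=> /(_ rx xy ry wy); have := w_le xN; rewrite wr; lia.
Qed.

Section LightEdge.
Variables (q r : V).
Hypotheses (qN : q \in N) (rN : r \in N) (qr : h q r) (wq : w q = 0)
  (wr : w r = 0).

Let card_light_nbhd :
  2 * n <= #|nbhd q :&: light| + #|nbhd r :&: light| + 2 * k + 2.
Proof.
have D := disjoint_nbhd qN rN qr wq wr.
have E : #|(nbhd q :|: nbhd r) :\: light| <= 2 * k.
  by apply: card_heavy; rewrite subUset !sub_nbhd.
have := cardsID light (nbhd q :|: nbhd r).
rewrite setIUl !cardsU [in X in _ - X]setIACA D set0I cards0.
have := deg_h qN; have := deg_h rN; lia.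
Qed.

Let card_light_r : n <= #|nbhd r :&: light| + 2 * k + 1.
Proof.
have := card_heavy (sub_nbhd r); have := cardsID light (nbhd r).
have := deg_h rN; lia.
Qed.

Lemma card_nbhdD z x : z \in N -> x \in nbhd r -> w x = 0 -> h z x ->
  #|nbhd z :\: nbhd r| <= w z + 3.
Proof.
rewrite inE => zN /andP[xN rx] wx zx.
have xr : nbhd x \subset N :\: nbhd r.
  apply/subsetP => y; rewrite !inE => /andP[yN xy]; rewrite yN andbT /=.
  apply/negP => ry.
  have yr : y \in nbhd r by rewrite inE yN.
  have := subsetP (nbhd_sub_side rN wr) y yr.
  rewrite inE yN -setI_eq0 => /eqP /setP /(_ x).
  by rewrite !inE xN rx wx h_sym xy.
have U : #|(nbhd z :\: nbhd r) :|: nbhd x| <= #|N :\: nbhd r|.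
  by apply: subset_leq_card; rewrite subUset xr setSD // sub_nbhd.
have I : #|(nbhd z :\: nbhd r) :&: nbhd x| <= #|nbhd z :&: nbhd x|.
  by apply: subset_leq_card; rewrite setSI // subsetDl.
have := cardsUI (nbhd z :\: nbhd r) (nbhd x).
have := cardsID (nbhd r) N; rewrite (setIidPr (sub_nbhd r)) card_N.
have := tri_h zN xN zx; have := deg_h xN; have := deg_h rN.
by rewrite wx wr; lia.
Qed.

Lemma edge_in_side z z' : z \in side r -> z' \in side r -> h z z' ->
  n + 3 <= (w z + 3) * (w z' + 3).
Proof.
rewrite !inE => /andP[zN zr] /andP[z'N z'r] zz'.
set X := nbhd r :&: light in zr z'r; set Y := nbhd q :&: light.
have XN : X \subset N by apply: subset_trans (subsetIl _ _) (sub_nbhd r).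
set C := N :\: X.
have cC : #|C| + #|X| = 2 * n.
  by rewrite -card_N -(cardsID X N) (setIidPr XN) addnC.
have zC : nbhd z \subset C by rewrite subsetD sub_nbhd.
have z'C : nbhd z' \subset C by rewrite subsetD sub_nbhd.
have YC : Y \subset C.
  rewrite subsetD (subset_trans (subsetIl _ _) (sub_nbhd q)) /=.
  rewrite -setI_eq0 setIACA (disjoint_nbhd qN rN qr wq wr).
  by rewrite set0I.
have U1 : #|nbhd z :|: nbhd z'| <= #|C|.
  by apply: subset_leq_card; rewrite subUset zC.
have U2 : #|(nbhd z :&: nbhd z') :|: Y| <= #|C|.
  by apply: subset_leq_card; rewrite subUset YC andbT (subset_trans (subsetIl _ _)).
have I1 := cardsUI (nbhd z) (nbhd z').
have I2 := cardsUI (nbhd z :&: nbhd z') Y.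
have : 0 < #|nbhd z :&: nbhd z' :&: Y|.
  move: card_light_nbhd card_light_r (deg_h zN) (deg_h z'N) linear_k.
  move: (w_le zN) (w_le z'N) U1 U2 I1 I2 cC.
  rewrite -/X -/Y; clear; lia.
case/card_gt0P => y; rewrite !inE => /andP[/andP[/andP[yN zy] /andP[_ z'y]]].
case/andP=> _ /eqP wy.
exact: triangle_weights zN z'N yN zz' zy z'y wy.
Qed.

Lemma heavy_edge_in_side z z' : z \in side r -> z' \in side r -> h z z' ->
  3 <= w z.
Proof.
move=> zr z'r zz'; have := edge_in_side zr z'r zz'.
move: z'r; rewrite inE => /andP[z'N _].
move: (w_le z'N) k_small n_large; nia.
Qed.

End LightEdge.

Definition inner (X : {set V}) := \sum_(x in X) #|nbhd x :&: X|.

Lemma sum_w_setU (X Y : {set V}) : X :|: Y = N -> [disjoint X & Y] ->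
  \sum_(x in X) w x + \sum_(y in Y) w y = 2 * k.
Proof.
move=> XY dXY; rewrite -sum_w -XY [RHS](big_setID X) /=; congr (_ + _).
  by apply: eq_bigl => z; rewrite !inE; case: (z \in X); rewrite ?andbF.
apply: eq_bigl => z; rewrite !inE; case zX: (z \in X) => //=.
by rewrite (disjointFr dXY zX).
Qed.

Lemma inner_balance (X Y : {set V}) : X :|: Y = N -> [disjoint X & Y] ->
  #|X| * n + \sum_(y in Y) w y + inner Y + #|Y| =
  #|Y| * n + \sum_(x in X) w x + inner X + #|X|.
Proof.
move=> XY dXY.
have degE (A B : {set V}) : A :|: B = N -> [disjoint A & B] ->
    #|A| * n = inner A + \sum_(x in A) #|nbhd x :&: B| +
               \sum_(x in A) w x + #|A|.
  move=> AB dAB; rewrite /inner -sum_nat_const -[#|A|]sum1_card -!big_split /=.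
  apply: eq_bigr => x xA.
  have xN : x \in N by rewrite -AB inE xA.
  rewrite -[LHS](deg_h xN); congr (_ + _ + _).
  rewrite -[in LHS](setIidPl (sub_nbhd x)) -AB setIUr cardsU setIACA setIid.
  by move: dAB; rewrite -setI_eq0 => /eqP ->; rewrite setI0 cards0 subn0.
have crossE : \sum_(x in X) #|nbhd x :&: Y| = \sum_(y in Y) #|nbhd y :&: X|.
  have cE (A B : {set V}) : B \subset N -> \sum_(x in A) #|nbhd x :&: B| =
      \sum_(x in A) \sum_(y in B) h x y.
    move=> BN; apply: eq_bigr => x _; rewrite -sum1_card big_mkcond /=.
    rewrite [RHS]big_mkcond /=; apply: eq_bigr => y _; rewrite !inE.
    by case yB: (y \in B); rewrite ?andbF ?andbT // (subsetP BN _ yB); case: h.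
  have [XN YN] : X \subset N /\ Y \subset N by rewrite -XY subsetUl subsetUr.
  rewrite !cE // exchange_big /=; apply: eq_bigr => y _.
  by apply: eq_bigr => x _; rewrite h_sym.
have := degE X Y XY dXY; have := degE Y X; rewrite setUC disjoint_sym crossE.
move=> /(_ XY dXY); lia.
Qed.

Lemma inner_le (X : {set V}) : X \subset N ->
  {in X &, forall x y, h x y -> 3 <= w x} ->
  9 * inner X <= (\sum_(x in X) w x) ^ 2.
Proof.
move=> XN heavy; rewrite /inner big_distrr /= expnS expn1 big_distrl /=.
apply: leq_sum => x xX; rewrite big_distrr /= -sum1_card big_distrr /=.
rewrite [leqRHS](bigID (mem (nbhd x :&: X))) /=.
apply: leq_trans (leq_addr _ _).
rewrite (eq_bigl (fun y => (y \in X) && (y \in nbhd x :&: X))); last first.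
  by move=> y; rewrite !inE; case: (y \in X); rewrite ?andbF.
apply: leq_sum => y; rewrite !inE => /andP[yX /andP[/andP[_ xy] _]].
have := heavy _ _ xX yX xy; rewrite h_sym in xy.
by have := heavy _ _ yX xX xy; nia.
Qed.

Lemma inner_gt0 (X : {set V}) : 0 < inner X ->
  exists x y, [/\ x \in X, y \in X & h x y].
Proof.
rewrite lt0n sum_nat_eq0 => /forall_inPn /= [x xX].
rewrite -lt0n => /card_gt0P[y]; rewrite !inE => /andP[/andP[_ xy] yX].
by exists x, y.
Qed.

Lemma inner_eq0 (X : {set V}) : X \subset N -> inner X = 0 ->
  {in X &, forall x y, ~~ h x y}.
Proof.
move=> /subsetP XN /eqP; rewrite sum_nat_eq0 => /forall_inP X0 x y xX yX.
have := X0 x xX; rewrite cards_eq0 => /eqP /setP /(_ y).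
by rewrite !inE yX XN // andbT /= => ->.
Qed.

(* An edge inside the half of smaller weight would have weights summing to at
   most k, against (k + 6)^2 / 4 < n + 3. *)
Lemma inner_lighter (X Y : {set V}) : X :|: Y = N -> [disjoint X & Y] ->
  #|X| = n -> #|Y| = n ->
  {in X &, forall x y, h x y -> n + 3 <= (w x + 3) * (w y + 3)} ->
  inner Y <= inner X -> inner X = 0.
Proof.
move=> XY dXY cX cY eX YX; apply/eqP; rewrite eqn0Ngt; apply/negP.
case/inner_gt0 => x [y [xX yX xy]].
have := inner_balance XY dXY; rewrite cX cY.
have := sum_w_setU XY dXY.
have : w x + w y <= \sum_(x in X) w x.
  have xy' : y != x by apply: contraTneq xy => ->; rewrite h_irr.
  by rewrite (bigD1 x) //= (bigD1 y) /= ?yX // addnA leq_addr.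
move: (eX _ _ xX yX xy) k_small n_large YX; clear.
move: (w x) (w y) (inner X) (inner Y) (\sum_(x in X) w x) (\sum_(x in Y) w x).
move=> a b i j s t H1 H2 H3 H4 H5 H6 H7.
have abk : a + b <= k by lia.
have amgm : 4 * ((a + 3) * (b + 3)) <= (k + 6) ^ 2.
  have : (a + b + 6) ^ 2 <= (k + 6) ^ 2 by rewrite leq_exp2r //; lia.
  nia.
nia.
Qed.

Theorem split_in_two_independent_sets : exists X : {set V},
  [/\ X \subset N, #|X| = n, {in X &, forall x y, ~~ h x y} &
      {in N :\: X &, forall x y, ~~ h x y}].
Proof.
have kn := linear_k.
have [q qN wq] : exists2 q, q \in N & w q = 0.
  by apply: exists_light => //; rewrite card_N; lia.
have [r] : exists2 r, r \in nbhd q & w r = 0.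
  by apply: exists_light (sub_nbhd q) _; have := deg_h qN; lia.
rewrite inE => /andP[rN qr] wr; have rq : h r q by rewrite h_sym.
pose X := side r; pose Y := N :\: X.
have XN : X \subset N by apply/subsetP => z; rewrite inE => /andP[].
have XY : X :|: Y = N by rewrite -{1}(setIidPr XN) setID.
have dXY : [disjoint X & Y] by rewrite disjoints_subset setCD subsetUr.
have inr : nbhd r \subset X := nbhd_sub_side rN wr.
have Yq : Y \subset side q.
  apply/subsetP => z; rewrite !inE => /andP[+ zN]; rewrite zN /=.
  rewrite -!setI_eq0 => /set0Pn[x]; rewrite !inE.
  case/andP=> /andP[xN zx] /andP[/andP[_ rx] /eqP wx].
  apply/set0Pn => -[y]; rewrite !inE.
  case/andP=> /andP[yN zy] /andP[/andP[_ qy] /eqP wy].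
  have xr : x \in nbhd r by rewrite inE xN.
  have yq : y \in nbhd q by rewrite inE yN.
  have := card_nbhdD qN rN qr wq wr zN xr wx zx.
  have := card_nbhdD rN qN rq wr wq zN yq wy zy.
  have := (leq_card_setU (nbhd z :\: nbhd r) (nbhd z :\: nbhd q)).1.
  rewrite -setDIr [nbhd r :&: _]setIC (disjoint_nbhd qN rN qr wq wr) setD0.
  by move: (deg_h zN) (w_le zN) kn n_large; clear; lia.
have inq : nbhd q \subset Y.
  apply/subsetP => y; rewrite !inE => /andP[yN qy]; rewrite yN andbT /=.
  rewrite -setI_eq0; apply/set0Pn; exists q.
  by rewrite !inE qN rq wq h_sym qy.
have eX := edge_in_side qN rN qr wq wr; rewrite -/X in eX.
have hX := heavy_edge_in_side qN rN qr wq wr; rewrite -/X in hX.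
have eY z z' : z \in Y -> z' \in Y -> h z z' -> n + 3 <= (w z + 3) * (w z' + 3).
  move=> /(subsetP Yq) zY /(subsetP Yq) z'Y.
  exact: edge_in_side rN qN rq wr wq _ _ zY z'Y.
have hY z z' : z \in Y -> z' \in Y -> h z z' -> 3 <= w z.
  move=> /(subsetP Yq) zY /(subsetP Yq) z'Y.
  exact: heavy_edge_in_side rN qN rq wr wq _ _ zY z'Y.
have [cX cY] : #|X| = n /\ #|Y| = n.
  have := subset_leq_card inr; have := subset_leq_card inq.
  have := deg_h qN; have := deg_h rN; rewrite wq wr.
  have := inner_le XN hX; have := inner_le (subsetDl N X) hY.
  have := inner_balance XY dXY; have := sum_w_setU XY dXY.
  have : #|X| + #|Y| = 2 * n.
    by rewrite -card_N -XY cardsU; move: dXY; rewrite -setI_eq0 => /eqP ->; rewrite cards0 subn0.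
  rewrite -/Y; move: k_small n_large kn; clear.
  move: (inner X) (inner Y) (\sum_(x in X) w x) (\sum_(x in Y) w x).
  move: #|X| #|Y| #|nbhd q| #|nbhd r| => x y a b i j s t.
  move=> H1 H2 H3 H4 H5 H6 H7 H8 H9 H10 H11 H12.
  have sk : (2 * k) ^ 2 = 4 * (k * k) by rewrite expnMn.
  have hi : 9 * i <= 4 * (k * k).
    by apply: leq_trans H8 _; rewrite -sk leq_exp2r //; lia.
  have hj : 9 * j <= 4 * (k * k).
    by apply: leq_trans H7 _; rewrite -sk leq_exp2r //; lia.
  have hk : k * k + 6 * k + 9 <= 2 * n by move: H1; clear; nia.
  clear H1 H7 H8 sk.
  have [|[|]] : x = n \/ x = n.+1 \/ x.+1 = n by lia.
  - lia.
  - move=> ?; subst x; have ? : n = y.+1 by lia.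
    subst n; lia.
  - move=> ?; subst n; have ? : y = x.+2 by lia.
    subst y; lia.
have i0 : inner X = 0 /\ inner Y = 0.
  have YX : Y :|: X = N by rewrite setUC.
  have dYX : [disjoint Y & X] by rewrite disjoint_sym.
  have [le | /ltnW le] := leqP (inner Y) (inner X).
    have iX := inner_lighter XY dXY cX cY eX le.
    by split=> //; apply/eqP; rewrite -leqn0 -iX.
  have iY := inner_lighter YX dYX cY cX eY le.
  by split=> //; apply/eqP; rewrite -leqn0 -iY.
exists X; split=> //; apply: inner_eq0; rewrite ?subsetDl //; by case: i0.
Qed.

End TwoIndependentSets.

(** * Partial linear spaces *)

Section PartialLinearSpace.
Variables (P : finType) (L : {set {set P}}).

Definition pencil (p : P) : {set {set P}} := [set l in L | p \in l].
Definition collinear (p q : P) := [exists l in L, (p \in l) && (q \in l)].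
Definition noncollinear (p : P) : {set P} :=
  [set q | (q != p) && ~~ collinear p q].

Hypothesis meet_le1 : {in L &, forall l m : {set P}, l != m -> #|l :&: m| <= 1}.

Lemma line_unique l m x y : l \in L -> m \in L -> x != y ->
  x \in l -> y \in l -> x \in m -> y \in m -> l = m.
Proof.
move=> lL mL xy xl yl xm ym; apply/eqP/negPn/negP => lm.
have := meet_le1 lL mL lm; rewrite leqNgt => /negP; apply.
by apply/card_gt1P; exists x, y; rewrite !inE xl yl xm ym.
Qed.

Lemma collinear_sym : symmetric collinear.
Proof. by move=> x y; apply: eq_existsb => l; rewrite [(x \in l) && _]andbC. Qed.

Lemma noncollinear_sym p q : (q \in noncollinear p) = (p \in noncollinear q).
Proof. by rewrite !inE collinear_sym eq_sym. Qed.

Lemma card_collinear (q : P) (B : {set P}) :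
  #|[set y in B | (q != y) && collinear q y]| =
  \sum_(l in pencil q) #|(l :&: B) :\ q|.
Proof.
have cE (l : {set P}) : #|(l :&: B) :\ q| = \sum_(y in B :\ q) (y \in l).
  rewrite -sum1_card big_mkcond [RHS]big_mkcond /=; apply: eq_bigr => y _.
  by rewrite !inE; case: (y \in l); case: (y \in B); case: eqP.
rewrite (eq_bigr _ (fun l _ => cE l)) exchange_big /= -sum1_card.
rewrite big_mkcond [RHS]big_mkcond /=; apply: eq_bigr => y _.
rewrite !inE eq_sym; case yq: (y == q); rewrite ?andbF //=.
case yB: (y \in B) => //=; rewrite /collinear; case: ifP => [/existsP[l /and3P[lL ql yl]] | nc].
  rewrite (bigD1 l) ?inE ?lL //= yl big1 // => m; rewrite inE => /andP[/andP[mL qm] ml].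
  apply/eqP; rewrite eqb0; apply: contra ml => ym; apply/eqP.
  by apply: (line_unique mL lL (negbT yq)).
rewrite big1 // => m; rewrite inE => /andP[mL qm]; apply/eqP; rewrite eqb0.
apply: contraFN nc => ym; apply/existsP; exists m.
by rewrite mL qm ym.
Qed.

Lemma sum_degree (B : {set P}) :
  \sum_(p in B) #|pencil p| = \sum_(l in L) #|l :&: B|.
Proof.
have cE (l : {set P}) : #|l :&: B| = \sum_(y in B) (y \in l).
  rewrite -sum1_card big_mkcond [RHS]big_mkcond /=; apply: eq_bigr => y _.
  by rewrite !inE; case: (y \in l); case: (y \in B).
rewrite [RHS](eq_bigr _ (fun l _ => cE l)) exchange_big /=.
apply: eq_bigr => y _; rewrite -sum1_card big_mkcond [RHS]big_mkcond /=.
by apply: eq_bigr => l _; rewrite !inE; case: (l \in L); case: (y \in l).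
Qed.

Lemma card_noncollinear k (p : P) : {in L, forall l : {set P}, #|l| = k.+1} ->
  #|noncollinear p| + k * #|pencil p| + 1 = #|P|.
Proof.
move=> Lk; have := card_collinear p [set: P].
rewrite (eq_bigr (fun=> k)); last first.
  move=> l; rewrite inE => /andP[lL pl]; rewrite setIT.
  by have := cardsD1 p l; rewrite pl Lk //; lia.
rewrite sum_nat_const mulnC => <-.
have := cardsC (noncollinear p); rewrite (cardsD1 p (~: _)) !inE eqxx /= => <-.
rewrite -addnA; congr (_ + _); rewrite addnC; congr (_ + _); apply: eq_card => y.
by rewrite !inE negb_and !negbK [p == y]eq_sym; case: eqP.
Qed.

Lemma card_line_noncollinear p l : l \in L -> p \notin l ->
  #|l| = #|l :&: noncollinear p| + \sum_(m in pencil p) #|m :&: l|.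
Proof.
move=> lL pl; rewrite -(cardsID (noncollinear p) l); congr (_ + _).
have := card_collinear p l.
rewrite (eq_bigr (fun m : {set P} => #|m :&: l|)) => [<- | m _]; last first.
  by congr #|pred_of_set _|; apply/setDidPl; rewrite disjoint_sym disjoints1 inE negb_and pl orbT.
apply: eq_card => y; rewrite !inE negb_and !negbK.
case yl: (y \in l); rewrite ?andbF //= [p == y]eq_sym andbT.
by case: eqP yl pl => //= -> ->.
Qed.

Lemma line_noncollinear0 p l : l \in L -> p \in l -> l :&: noncollinear p = set0.
Proof.
move=> lL pl; apply/setP => y; rewrite !inE; apply/negP => /and3P[yl _ /negP].
by apply; apply/existsP; exists l; rewrite lL pl yl.
Qed.

End PartialLinearSpace.

(** * Extending partial projective planes *)

Record partial_projective_plane (P : finType) (n : nat) (L : {set {set P}}) :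
    Prop := PartialProjectivePlane {
  ppp_points : #|P| = n ^ 2 + n + 1;
  ppp_line_size : {in L, forall l : {set P}, #|l| = n.+1};
  ppp_meet : {in L &, forall l m : {set P}, l != m -> #|l :&: m| = 1}
}.

Section PartialProjectivePlane.
Variables (P : finType) (n : nat) (L : {set {set P}}).
Hypothesis hL : partial_projective_plane n L.
Hypothesis n_gt0 : 0 < n.

Let L_size := ppp_line_size hL.
Let L_meet1 := ppp_meet hL.

Let L_meet : {in L &, forall l m : {set P}, l != m -> #|l :&: m| <= 1}.
Proof. by move=> l m lL mL lm; rewrite L_meet1. Qed.

Lemma degree_le p : #|pencil L p| <= n.+1.
Proof.
have := card_noncollinear L_meet p L_size; rewrite (ppp_points hL).
by move: n_gt0; case: (leqP #|pencil L p| n.+1) => //; nia.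
Qed.

Definition deficiency (p : P) := n.+1 - #|pencil L p|.

Lemma degree_deficiency p : #|pencil L p| + deficiency p = n.+1.
Proof. by rewrite subnKC // degree_le. Qed.

Lemma card_noncollinear_pp p : #|noncollinear L p| = n * deficiency p.
Proof.
have := card_noncollinear L_meet p L_size; rewrite (ppp_points hL).
by have := degree_deficiency p; move: #|pencil L p| (deficiency p) => r e; nia.
Qed.

Lemma card_line_noncollinear_pp p l : l \in L -> p \notin l ->
  #|l :&: noncollinear L p| = deficiency p.
Proof.
move=> lL pl; have := card_line_noncollinear L_meet lL pl.
rewrite (eq_bigr (fun=> 1)); last first.
  move=> m; rewrite inE => /andP[mL pm]; rewrite L_meet1 //.
  by apply: contraNneq pl => <-.
by rewrite sum1_card L_size // -(degree_deficiency p); lia.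
Qed.

Lemma sum_degree_noncollinear p :
  \sum_(q in noncollinear L p) #|pencil L q| + #|pencil L p| * deficiency p =
  #|L| * deficiency p.
Proof.
rewrite sum_degree (big_setID (pencil L p)) /= big1; last first.
  move=> l; rewrite !inE => /and3P[_ lL pl].
  by rewrite (line_noncollinear0 lL pl) cards0.
rewrite add0n (eq_bigr (fun=> deficiency p)); last first.
  move=> l; rewrite !inE => /andP[+ lL]; rewrite lL /=.
  exact: card_line_noncollinear_pp.
rewrite sum_nat_const -mulnDl; congr (_ * _).
have := cardsID (pencil L p) L; rewrite (setIidPr _) 1?addnC //.
by apply/subsetP => l; rewrite inE => /andP[].
Qed.

Lemma sum_deficiency_noncollinear p :
  \sum_(q in noncollinear L p) deficiency q + (#|L| + deficiency p) * deficiency p =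
  n.+1 ^ 2 * deficiency p.
Proof.
have : \sum_(q in noncollinear L p) (#|pencil L q| + deficiency q) =
    \sum_(q in noncollinear L p) n.+1.
  by apply: eq_bigr => q _; rewrite degree_deficiency.
rewrite big_split /= sum_nat_const card_noncollinear_pp.
have := sum_degree_noncollinear p; have := degree_deficiency p.
move/(congr1 (muln (deficiency p))); clear.
move: (deficiency p) #|pencil L p| (\sum_(_ in _) _) (\sum_(_ in _) _).
move: #|L| => b e r s t h1 h2 h3.
have : e * r + e * e = e * n + e by move: h1; clear; lia.
by rewrite -mulnn; move: h2 h3; clear; lia.
Qed.

Lemma card_noncollinear_collinear p q : q \in noncollinear L p ->
  #|[set y in noncollinear L p | (q != y) && collinear L q y]| =
  #|pencil L q| * (deficiency p).-1.
Proof.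
move=> qp; rewrite card_collinear // -sum_nat_const.
apply: eq_bigr => l; rewrite inE => /andP[lL ql].
have pl : p \notin l.
  apply: contraL qp => pl; have := line_noncollinear0 lL pl.
  by move=> /setP /(_ q); rewrite in_set0 in_setI ql /= => ->.
rewrite -(card_line_noncollinear_pp lL pl).
by rewrite [in RHS](cardsD1 q) in_setI ql qp.
Qed.

Lemma card_noncollinearI x y : x != y -> collinear L x y ->
  #|noncollinear L x :&: noncollinear L y| = deficiency x * deficiency y.
Proof.
move=> xy /existsP[l /and3P[lL xl yl]].
have := cardsID (noncollinear L y) (noncollinear L x).
have yx : y \notin noncollinear L x.
  by rewrite inE negb_and negbK negbK; apply/orP; right; apply/existsP; exists l; rewrite lL xl.
have -> : noncollinear L x :\: noncollinear L y =
    [set z in noncollinear L x | (y != z) && collinear L y z].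
  apply/setP => z; rewrite [in LHS]inE [in RHS]inE andbC.
  case zx: (z \in noncollinear L x) => //=.
  rewrite inE negb_and !negbK eq_sym.
  by case: eqP zx yx => //= -> ->.
rewrite card_collinear //.
have lp : l \in pencil L y by rewrite inE lL.
rewrite (bigD1 l) //= (line_noncollinear0 lL xl) set0D cards0 add0n.
rewrite (eq_bigr (fun=> deficiency x)); last first.
  move=> m /andP[]; rewrite inE => /andP[mL ym] ml.
  rewrite (setDidPl _) ?card_line_noncollinear_pp //.
    apply: contra ml => xm; apply/eqP.
    exact: (line_unique L_meet mL lL xy).
  by rewrite disjoint_sym disjoints1 inE negb_and yx orbT.
rewrite (eq_bigl (mem (pencil L y :\ l))); last first.
  by move=> m; rewrite !inE andbC.
rewrite sum_nat_const card_noncollinear_pp.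
have := cardsD1 l (pencil L y); rewrite lp => h1.
have := degree_deficiency y; move: (deficiency x) (deficiency y) => a b; rewrite h1.
by move: #|pencil L y :\ l| => r; nia.
Qed.

Lemma new_line_meets p (X : {set P}) : X \subset noncollinear L p ->
  (forall l, l \in L -> p \notin l -> #|l :&: X| = 1) ->
  {in L, forall l : {set P}, #|l :&: (p |: X)| = 1}.
Proof.
move=> /subsetP Xp X1 l lL; case pl: (p \in l).
  have -> : l :&: (p |: X) = [set p].
    apply/setP => y; rewrite !inE; case: eqP => [-> | _] /=; first by rewrite pl.
    apply/negP => /andP[yl /Xp yp].
    by have := line_noncollinear0 lL pl => /setP /(_ y); rewrite in_set0 in_setI yl yp.
  by rewrite cards1.
rewrite -[RHS](X1 _ lL (negbT pl)); apply: eq_card => y; rewrite !inE.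
by case: eqP => [-> | _] //=; rewrite pl.
Qed.


Lemma split_noncollinear p : deficiency p = 2 ->
  {in noncollinear L p, forall q, 2 <= deficiency q} ->
  {in noncollinear L p, forall q, deficiency q + #|L| <= n ^ 2 + 1} ->
  (n ^ 2 + 1 - #|L| + 1) ^ 2 <= 2 * n -> 49 <= n ->
  exists X : {set P}, [/\ X \subset noncollinear L p, #|X| = n &
    forall l, l \in L -> p \notin l -> #|l :&: X| = 1].
Proof.
move=> ep e_ge2 e_le s_small n_large.
set N := noncollinear L p.
pose h x y := (x != y) && collinear L x y.
pose w x := deficiency x - 2.
have wE x : x \in N -> deficiency x = w x + 2 by move/e_ge2; rewrite /w; lia.
have hs : symmetric h by move=> x y; rewrite /h eq_sym collinear_sym.
have hi : irreflexive h by move=> x; rewrite /h eqxx.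
have cN : #|N| = 2 * n by rewrite /N card_noncollinear_pp ep mulnC.
have deg : {in N, forall x, #|nbhd N h x| + w x + 1 = n}.
  move=> x xN; rewrite card_noncollinear_collinear // ep muln1.
  by have := degree_deficiency x; rewrite (wE x xN); lia.
have tri : {in N &, forall x y, h x y ->
    #|nbhd N h x :&: nbhd N h y| <= (w x).+1 * (w y).+1}.
  move=> x y xN yN hxy; have /andP[xy cxy] := hxy.
  have := card_noncollinearI xy cxy; rewrite (wE x xN) (wE y yN).
  have pI : p \in noncollinear L x :&: noncollinear L y.
    by rewrite in_setI -!(noncollinear_sym L p) xN.
  rewrite (cardsD1 p) pI => cI.
  have UI : N :\: (nbhd N h x :|: nbhd N h y) \subset
      (noncollinear L x :&: noncollinear L y) :\ p.
    apply/subsetP => z; rewrite !in_setD !in_setU !in_setI in_set1 !nbhdP.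
    case/andP; rewrite negb_or => /andP[hxz hyz] zN; rewrite zN /= in hxz hyz.
    have -> /= : z != p by move: zN; rewrite inE => /andP[].
    rewrite 2!inE [z == x]eq_sym [z == y]eq_sym.
    move: hxz hyz; rewrite /h; case: (x =P z) => [<- | _] /=.
      by move: hxy; rewrite hs /h => ->.
    by case: (y =P z) hxy => [<- | _ _ -> ->] //=; rewrite /h => /andP[_ ->].
  have := subset_leq_card UI.
  have := cardsID (nbhd N h x :|: nbhd N h y) N.
  have -> : N :&: (nbhd N h x :|: nbhd N h y) = nbhd N h x :|: nbhd N h y.
    by apply/setIidPr; rewrite subUset !sub_nbhd.
  have := cardsUI (nbhd N h x) (nbhd N h y).
  have := deg x xN; have := deg y yN; rewrite cN.
  by move: cI; clear; nia.
have [q0 q0N] : exists q, q \in N by apply/card_gt0P; rewrite cN; lia.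
have sw : \sum_(x in N) w x = 2 * (n ^ 2 + 1 - #|L| - 2).
  have := sum_deficiency_noncollinear p; rewrite ep -/N.
  have -> : \sum_(q in N) deficiency q = \sum_(x in N) w x + 2 * (2 * n).
    rewrite -cN mulnC -sum_nat_const -big_split /=.
    by apply: eq_bigr => x xN; rewrite wE.
  have := e_le _ q0N; have := e_ge2 _ q0N; rewrite -!mulnn.
  by clear; lia.
have wk : {in N, forall x, w x <= n ^ 2 + 1 - #|L| - 2}.
  by move=> x xN; have := e_le x xN; rewrite /w; clear; lia.
have k2 : (n ^ 2 + 1 - #|L| - 2 + 3) ^ 2 <= 2 * n.
  have -> : n ^ 2 + 1 - #|L| - 2 + 3 = n ^ 2 + 1 - #|L| + 1.
    by have := e_le _ q0N; have := e_ge2 _ q0N; clear; lia.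
  exact: s_small.
have [X [XN cX X0 X1]] :=
  split_in_two_independent_sets hs hi cN deg tri sw wk k2 n_large.
exists X; split=> // l lL pl.
have := card_line_noncollinear_pp lL pl; rewrite ep -/N -(cardsID X).
have half (Z : {set P}) : {in Z &, forall x y, ~~ h x y} -> #|l :&: Z| <= 1.
  move=> Z0; rewrite leqNgt; apply/card_gt1P => -[x [y []]].
  rewrite !inE => /andP[xl xZ] /andP[yl yZ] xy.
  case/negP: (Z0 x y xZ yZ); rewrite /h xy; apply/existsP; exists l.
  by rewrite lL xl.
have -> : l :&: N :&: X = l :&: X.
  by rewrite -setIA [N :&: X](setIidPr XN).
have -> : l :&: N :\: X = l :&: (N :\: X) by rewrite setIDA.
by have := half _ X0; have := half _ X1; clear; lia.
Qed.

Lemma exists_new_line : #|L| < n ^ 2 + n + 1 ->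
  (n ^ 2 + 1 - #|L| + 1) ^ 2 <= 2 * n -> 49 <= n ->
  exists2 X : {set P}, #|X| = n.+1 & {in L, forall l : {set P}, #|l :&: X| = 1}.
Proof.
move=> L_lt s_small n_large.
have [p0 ep0] : exists p, 0 < deficiency p.
  apply/existsP; rewrite -[X in is_true X]negbK negb_exists; apply/negP.
  move=> /forallP e0.
  have := sum_degree L [set: P].
  rewrite (eq_bigr (fun=> n.+1)); last first.
    by move=> p _; have := degree_deficiency p; move: (e0 p); rewrite lt0n negbK => /eqP ->; lia.
  rewrite [RHS](eq_bigr (fun=> n.+1)); last first.
    by move=> l lL; rewrite setIT L_size.
  by rewrite !sum_nat_const cardsT (ppp_points hL); nia.
have [p /eqP ep | no1] := pickP (fun p => deficiency p == 1).
  exists (p |: noncollinear L p).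
    rewrite cardsU1 card_noncollinear_pp ep muln1.
    by rewrite inE eqxx.
  apply: new_line_meets => // l lL pl.
  by rewrite card_line_noncollinear_pp.
have e_ge2 p q : q \in noncollinear L p -> 2 <= deficiency q.
  rewrite noncollinear_sym => pq.
  have : 0 < #|noncollinear L q| by apply/card_gt0P; exists p.
  rewrite card_noncollinear_pp muln_gt0 n_gt0 /=.
  by have := no1 q; case: (deficiency q) => [|[|]].
have e_le p : 0 < deficiency p -> deficiency p + #|L| <= n ^ 2 + 1.
  move=> ep; have := sum_deficiency_noncollinear p.
  have : \sum_(q in noncollinear L p) 2 <= \sum_(q in noncollinear L p) deficiency q.
    by apply: leq_sum => q; apply: e_ge2.
  rewrite sum_nat_const card_noncollinear_pp.
  move: ep; move: (deficiency p) (\sum_(_ in _) _) #|L| => e s b.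
  clear; nia.
have [p ep] : exists p, deficiency p = 2.
  have [p /andP[_ /eqP ep] | no2] :=
      pickP (fun q => (q \in noncollinear L p0) && (deficiency q == 2)).
    by exists p.
  have := sum_deficiency_noncollinear p0; have := e_le p0 ep0.
  have : \sum_(q in noncollinear L p0) 3 <= \sum_(q in noncollinear L p0) deficiency q.
    apply: leq_sum => q qp; have := e_ge2 _ _ qp; have := no2 q.
    by rewrite qp /=; case: (deficiency q) => [|[|[|]]].
  rewrite sum_nat_const card_noncollinear_pp.
  move: s_small n_large ep0; move: (deficiency p0) (\sum_(_ in _) _) #|L| => e s b.
  clear; nia.
have e2 : {in noncollinear L p, forall q, deficiency q + #|L| <= n ^ 2 + 1}.
  by move=> q /e_ge2 eq; apply: e_le; lia.
have [X [Xp cX X1]] := split_noncollinear ep (e_ge2 p) e2 s_small n_large.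
exists (p |: X); last exact: new_line_meets.
rewrite cardsU1 cX; have -> // : p \notin X.
by apply/negP => /(subsetP Xp); rewrite inE eqxx.
Qed.

End PartialProjectivePlane.

Lemma sum_degree_pp (P : finType) (n : nat) (L : {set {set P}}) :
  partial_projective_plane n L ->
  \sum_(p in [set: P]) #|pencil L p| = n.+1 * #|L|.
Proof.
move=> hL; rewrite sum_degree mulnC -sum_nat_const.
by apply: eq_bigr => l lL; rewrite setIT (ppp_line_size hL).
Qed.

Lemma card_lines_le (P : finType) (n : nat) (L : {set {set P}}) :
  0 < n -> partial_projective_plane n L -> #|L| <= n ^ 2 + n + 1.
Proof.
move=> n_gt0 hL.
have : \sum_(p in [set: P]) #|pencil L p| <= \sum_(p in [set: P]) n.+1.
  by apply: leq_sum => p _; apply: degree_le hL n_gt0 p.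
by rewrite (sum_degree_pp hL) sum_nat_const cardsT (ppp_points hL) mulnC leq_pmul2r.
Qed.

Lemma partial_projective_planeU1 (P : finType) (n : nat) (L : {set {set P}})
    (X : {set P}) :
  partial_projective_plane n L -> #|X| = n.+1 ->
  {in L, forall l : {set P}, #|l :&: X| = 1} ->
  partial_projective_plane n (X |: L).
Proof.
move=> hL cX X1; split; first exact: ppp_points hL.
  by move=> l /setU1P[-> // | /(ppp_line_size hL)].
move=> l m /setU1P[-> | lL] /setU1P[-> | mL]; rewrite ?eqxx // => lm.
- by rewrite setIC X1.
- by rewrite X1.
- exact: ppp_meet hL _ _ lL mL lm.
Qed.

Theorem complete_partial_projective_plane (P : finType) (n : nat)
    (L : {set {set P}}) :
  49 <= n -> partial_projective_plane n L ->
  (n ^ 2 + 1 - #|L| + 1) ^ 2 <= 2 * n ->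
  exists L' : {set {set P}}, [/\ L \subset L', partial_projective_plane n L' &
    #|L'| = n ^ 2 + n + 1].
Proof.
move=> n49; have n_gt0 : 0 < n by apply: leq_trans n49.
have [d] := ubnP (n ^ 2 + n + 1 - #|L|).
elim: d L => // d IH L Ld hL hs.
have [L_ge | L_lt] := leqP (n ^ 2 + n + 1) #|L|.
  exists L; split=> //; apply/eqP; rewrite eqn_leq L_ge andbT.
  exact: card_lines_le.
have [X cX X1] := exists_new_line hL n_gt0 L_lt hs n49.
have XL : X \notin L by apply/negP => /X1; rewrite setIid cX => -[n0]; rewrite n0 in n_gt0.
have := IH (X |: L); rewrite cardsU1 XL => /(_ _ (partial_projective_planeU1 hL cX X1)).
case=> [||L' [LL' hL' cL']]; first by move: Ld L_lt; clear; lia.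
  by apply: leq_trans hs; rewrite leq_exp2r //; clear; lia.
by exists L'; split=> //; apply: subset_trans LL'; apply: subsetU1.
Qed.

Lemma collinear_projective_plane (P : finType) (n : nat) (L : {set {set P}}) :
  0 < n -> partial_projective_plane n L -> #|L| = n ^ 2 + n + 1 ->
  forall p q, p != q -> collinear L p q.
Proof.
move=> n_gt0 hL cL p q pq.
have : \sum_(x in [set: P]) (#|pencil L x| + deficiency n L x) =
    \sum_(x in [set: P]) n.+1.
  by apply: eq_bigr => x _; rewrite (degree_deficiency hL n_gt0).
rewrite big_split /= (sum_degree_pp hL) sum_nat_const cardsT (ppp_points hL) cL.
rewrite mulnC -[RHS]addn0 => /addnI /eqP; rewrite sum_nat_eq0.
move=> /forall_inP /(_ p (in_setT p)) /eqP e0.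
have := card_noncollinear_pp hL n_gt0 p; rewrite e0 muln0 => /eqP.
rewrite cards_eq0 => /eqP /setP /(_ q); rewrite !inE eq_sym pq /=.
by move/negbFE.
Qed.

(** * Projective closure *)

Section AffinePart.
Variables (T : finType) (n : nat) (L : {set {set T + 'I_n.+1}}).

Definition line_at_infinity : {set T + 'I_n.+1} := [set inr i | i : 'I_n.+1].
Definition affine_part (m : {set T + 'I_n.+1}) : {set T} := [set x | inl x \in m].
Definition affine_lines : {set {set T}} :=
  [set affine_part m | m in L :\ line_at_infinity].

Hypothesis n_gt1 : 2 <= n.
Hypothesis hL : partial_projective_plane n L.
Hypothesis L_inf : line_at_infinity \in L.
Hypothesis cL : #|L| = n ^ 2 + n + 1.

Let n_gt0 : 0 < n. Proof. exact: ltnW. Qed.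
Let L_meet : {in L &, forall l m : {set T + 'I_n.+1}, l != m -> #|l :&: m| <= 1}.
Proof. by move=> l m lL mL lm; rewrite (ppp_meet hL). Qed.

Lemma inl_infinity x : (inl x \in line_at_infinity) = false.
Proof. by apply/imsetP => -[]. Qed.

Lemma inr_infinity i : inr i \in line_at_infinity.
Proof. exact: imset_f. Qed.

Lemma affine_partP x (m : {set T + 'I_n.+1}) : (x \in affine_part m) = (inl x \in m).
Proof. by rewrite inE. Qed.

Lemma affine_linesP (l : {set T}) :
  reflect (exists m, [/\ m \in L, m != line_at_infinity & l = affine_part m])
          (l \in affine_lines).
Proof.
apply: (iffP imsetP) => [[m /setD1P[mi mL] ->] | [m [mL mi ->]]]; first by exists m.
by exists m => //; apply/setD1P.
Qed.

Lemma point_at_infinity m : m \in L -> m != line_at_infinity ->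
  exists i, m :&: line_at_infinity = [set inr i].
Proof.
move=> mL mi; have /eqP/cards1P[z mz] := ppp_meet hL mL L_inf mi.
have : z \in m :&: line_at_infinity by rewrite mz set11.
by rewrite inE => /andP[_ /imsetP[i _ zi]]; exists i; rewrite mz zi.
Qed.

Lemma card_affine_part m : m \in L -> m != line_at_infinity ->
  #|affine_part m| = n.
Proof.
move=> mL mi; have := cardsID line_at_infinity m.
rewrite (ppp_meet hL mL L_inf mi) (ppp_line_size hL mL) add1n => -[<-].
rewrite -(card_imset _ (@inl_inj T 'I_n.+1)); congr #|pred_of_set _|.
apply/setP => -[x | i]; rewrite inE.
  by rewrite (mem_imset _ _ inl_inj) inE inl_infinity.
by rewrite inr_infinity; apply/imsetP => -[].
Qed.

Lemma join_lines (p q : T + 'I_n.+1) : p != q ->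
  exists m, [/\ m \in L, p \in m & q \in m].
Proof.
move/(collinear_projective_plane n_gt0 hL cL) => /existsP[m /and3P[]].
by exists m.
Qed.

Lemma affine_line_neq x (m : {set T + 'I_n.+1}) : inl x \in m -> m != line_at_infinity.
Proof. by apply: contraTneq => ->; rewrite inl_infinity. Qed.

Lemma affine_lines_affine_plane : affine_plane n affine_lines.
Proof.
have join x y : x != y ->
    exists! l : {set T}, [/\ l \in affine_lines, x \in l & y \in l].
  move=> xy; have xy' : inl x != inl y :> T + 'I_n.+1 by rewrite (inj_eq inl_inj).
  have [m [mL xm ym]] := join_lines xy'.
  exists (affine_part m); split.
    rewrite !affine_partP xm ym; split=> //; apply/affine_linesP; exists m.
    by split=> //; apply: affine_line_neq xm.
  move=> l [/affine_linesP[m' [m'L _ ->]]]; rewrite !affine_partP => xm' ym'.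
  by rewrite (line_unique L_meet mL m'L xy' xm ym xm' ym').
split=> //.
- by move=> l /affine_linesP[m [mL mi ->]]; apply: card_affine_part.
- move=> x l /affine_linesP[m [mL mi ->]]; rewrite affine_partP => xm.
  have [i mI] := point_at_infinity mL mi.
  have im : inr i \in m.
    by have /setIP[] : inr i \in m :&: line_at_infinity by rewrite mI set11.
  have xi : inl x != inr i :> T + 'I_n.+1 by [].
  have [m' [m'L xm' im']] := join_lines xi.
  have mm' : m != m' by apply: contraNneq xm => ->.
  exists (affine_part m'); split.
    rewrite affine_partP xm'; split=> //.
      by apply/affine_linesP; exists m'; split=> //; apply: affine_line_neq xm'.
    rewrite -setI_eq0; apply/eqP/setP => y; rewrite in_setI !affine_partP in_set0.
    apply/negP => /andP[ym ym'].
    have yi : inl y != inr i :> T + 'I_n.+1 by [].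
    by rewrite (line_unique L_meet mL m'L yi ym im ym' im') eqxx in mm'.
  move=> k [/affine_linesP[m2 [m2L m2i ->]]]; rewrite affine_partP => xm2 dis.
  have mm2 : m != m2 by apply: contraNneq xm => ->.
  have /eqP/cards1P[z mz] := ppp_meet hL mL m2L mm2.
  have /setIP[zm zm2] : z \in m :&: m2 by rewrite mz set11.
  case: z zm zm2 {mz} => [y | j] zm zm2.
    by have := disjointFr dis; move/(_ y); rewrite !affine_partP zm zm2 => /(_ isT).
  have : inr j \in m :&: line_at_infinity by rewrite in_setI zm inr_infinity.
  rewrite mI inE => /eqP ji; rewrite ji in zm2.
  by rewrite (line_unique L_meet m'L m2L xi xm' im' xm2 zm2).
- have cT : #|T| = n ^ 2.
    have := ppp_points hL; rewrite card_sum card_ord; clear; lia.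
  have /card_gt1P[x [y [_ _ xy]]] : 1 < #|[set: T]|.
    by rewrite cardsT cT -(exp1n 2) ltn_exp2r.
  have [l [[lA xl yl] lU]] := join x y xy.
  have [z zl] : exists z, z \notin l.
    have cl : #|l| = n.
      by case/affine_linesP: lA => m [mL mi ->]; apply: card_affine_part.
    have /card_gt0P[z] : 0 < #|~: l|.
      have := cardsC l; rewrite cl cT.
      by move: n_gt1; case: #|~: l| => [|//]; clear; nia.
    by rewrite inE; exists z.
  exists x, y, z; split=> //.
  + by apply: contraNneq zl => <-.
  + by apply: contraNneq zl => <-.
  + move=> m mA; apply/negP => /and3P[xm ym zm].
    by rewrite (lU m) ?zm // in zl.
Qed.

End AffinePart.

Section ProjectiveClosure.
Variables (T : finType) (n : nat) (A : {set {set T}}).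
Variable direction : {set T} -> 'I_n.+1.
Hypothesis hA : partial_affine_plane n A.
Hypothesis directionP :
  {in A &, forall l m : {set T}, (direction l == direction m) = parallel l m}.

Definition projective_line (l : {set T}) : {set T + 'I_n.+1} :=
  inr (direction l) |: [set inl x | x in l].

Definition projective_lines : {set {set T + 'I_n.+1}} :=
  line_at_infinity T n |: [set projective_line l | l in A].

Lemma inl_projective_line x l : (inl x \in projective_line l) = (x \in l).
Proof. by rewrite !inE /= (mem_imset _ _ inl_inj). Qed.

Lemma inr_projective_line i l : (inr i \in projective_line l) = (i == direction l).
Proof.
rewrite !inE (inj_eq inr_inj); case: eqP => //= _.
by apply/imsetP => -[].
Qed.

Lemma affine_part_projective_line l : affine_part (projective_line l) = l.
Proof. by apply/setP => x; rewrite inE inl_projective_line. Qed.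

Lemma projective_line_inj : injective projective_line.
Proof. exact: can_inj affine_part_projective_line. Qed.

Lemma projective_line_neq l : l \in A -> projective_line l != line_at_infinity T n.
Proof.
move=> lA; have /card_gt0P[x xl] : 0 < #|l|.
  by rewrite (pap_line_size hA lA); apply: ltnW (pap_order hA).
by apply: (@affine_line_neq _ _ x); rewrite inl_projective_line.
Qed.

Lemma card_projective_lines : #|projective_lines| = #|A|.+1.
Proof.
rewrite cardsU1 card_imset; last exact: projective_line_inj.
case: imsetP => // -[l lA] /eqP; rewrite eq_sym.
by rewrite (negPf (projective_line_neq lA)).
Qed.

Lemma projective_lines_partial_plane : partial_projective_plane n projective_lines.
Proof.
have inf_meet l : #|projective_line l :&: line_at_infinity T n| = 1.
  apply/eqP/cards1P; exists (inr (direction l)); apply/setP => -[x | i].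
    by rewrite in_setI inl_infinity andbF inE.
  by rewrite in_setI inr_infinity andbT inr_projective_line inE (inj_eq inr_inj).
split.
- by rewrite card_sum card_ord (pap_points hA); clear; lia.
- move=> l /setU1P[-> | /imsetP[m mA ->]].
    by rewrite card_imset ?card_ord //; apply: inr_inj.
  rewrite cardsU1 card_imset; last exact: inl_inj.
  rewrite (pap_line_size hA mA); have -> // : inr (direction m) \notin [set inl x | x in m].
  by apply/imsetP => -[].
- move=> l m /setU1P[-> | /imsetP[l' lA ->]] /setU1P[-> | /imsetP[m' mA ->]] lm.
  + by rewrite eqxx in lm.
  + by rewrite setIC inf_meet.
  + by rewrite inf_meet.
  have {}lm : l' != m' by apply: contraNneq lm => ->.
  have := directionP lA mA; rewrite /parallel (negPf lm) /=.
  case dis: [disjoint l' & m'] => dE.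
    apply/eqP/cards1P; exists (inr (direction l')); apply/setP => -[x | i].
      rewrite in_setI !inl_projective_line inE.
      by case xl: (x \in l') => //=; rewrite (disjointFr dis xl).
    rewrite in_setI !inr_projective_line inE (inj_eq inr_inj) -(eqP dE).
    by rewrite andbb.
  have le1 := pap_meet hA lA mA lm.
  have /eqP/cards1P[x lmx] : #|l' :&: m'| = 1.
    by apply/eqP; rewrite eqn_leq le1 card_gt0 setI_eq0 dis.
  apply/eqP/cards1P; exists (inl x); apply/setP => -[y | i].
    rewrite in_setI !inl_projective_line -in_setI lmx !inE.
    by rewrite (inj_eq inl_inj).
  rewrite in_setI !inr_projective_line inE /=.
  by case: eqP => //= ->; rewrite dE.
Qed.

Theorem completable_of_direction :
  49 <= n -> (n ^ 2 - #|A| + 1) ^ 2 <= 2 * n -> completable n A.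
Proof.
move=> n49 hs.
have [|L' [LL' hL' cL']] :=
    complete_partial_projective_plane n49 projective_lines_partial_plane.
  by rewrite card_projective_lines [n ^ 2 + 1]addn1 subSS.
exists (affine_lines L').
  apply: affine_lines_affine_plane => //; first exact: pap_order hA.
  by apply: (subsetP LL'); apply: setU11.
apply/subsetP => l lA; apply/affine_linesP; exists (projective_line l).
split; last by rewrite affine_part_projective_line.
  by apply: (subsetP LL'); apply/setU1P; right; apply: imset_f.
exact: projective_line_neq.
Qed.

End ProjectiveClosure.

(** * The number of parallel classes *)

Section ParallelClasses.
Variables (T : finType) (n : nat) (A : {set {set T}}).
Hypothesis hA : partial_affine_plane n A.
Hypothesis hpar : {in A & &, equivalence_rel (@parallel T)}.

Definition parallel_class (l : {set T}) : {set {set T}} :=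
  [set m in A | parallel l m].
Definition parallel_classes : {set {set {set T}}} :=
  equivalence_partition (@parallel T) A.

Let n_gt1 : 1 < n. Proof. exact: pap_order hA. Qed.
Let A_size : {in A, forall l : {set T}, #|l| = n} := @pap_line_size _ _ _ hA.
Let A_meet : {in A &, forall l m : {set T}, l != m -> #|l :&: m| <= 1} :=
  @pap_meet _ _ _ hA.

Lemma parallel_refl (l : {set T}) : parallel l l.
Proof. by rewrite /parallel eqxx. Qed.

Lemma parallel_sym (l m : {set T}) : parallel l m = parallel m l.
Proof. by rewrite /parallel eq_sym disjoint_sym. Qed.

Lemma parallel_classP l m : l \in A -> m \in A ->
  (parallel_class l == parallel_class m) = parallel l m.
Proof.
move=> lA mA; apply/eqP/idP => [/setP /(_ m) | lm].
  by rewrite !inE mA parallel_refl.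
apply/setP => k; rewrite !inE; case kA: (k \in A) => //=.
by have [_ ->] := hpar lA mA kA.
Qed.

Lemma mem_parallel_classes l : l \in A -> parallel_class l \in parallel_classes.
Proof. exact: imset_f. Qed.

Lemma parallel_classesP C :
  reflect (exists2 l, l \in A & C = parallel_class l) (C \in parallel_classes).
Proof. exact: imsetP. Qed.

Lemma partition_parallel_classes : partition parallel_classes A.
Proof. exact: equivalence_partitionP. Qed.

Lemma parallel_classE l m : l \in A -> m \in parallel_class l ->
  parallel_class m = parallel_class l.
Proof.
move=> lA; rewrite inE => /andP[mA lm].
by apply/eqP; rewrite parallel_classP // parallel_sym.
Qed.

Lemma parallel_meet0 (l m : {set T}) x :
  parallel l m -> x \in l -> x \in m -> l = m.
Proof. by case/orP => [/eqP // | /disjointFr dis] /dis ->. Qed.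

Lemma nonparallel_meet l m : l \in A -> m \in A -> ~~ parallel l m ->
  #|l :&: m| = 1.
Proof.
move=> lA mA; rewrite /parallel negb_or => /andP[lm dis]; apply/eqP.
by rewrite eqn_leq A_meet // card_gt0 setI_eq0.
Qed.

Lemma exists_direction : #|parallel_classes| <= n.+1 ->
  exists direction : {set T} -> 'I_n.+1, {in A &, forall l m : {set T},
    (direction l == direction m) = parallel l m}.
Proof.
move=> c_le; pose i (l : {set T}) := index (parallel_class l) (enum parallel_classes).
have i_lt l : l \in A -> i l < n.+1.
  by move=> lA; apply: leq_trans c_le; rewrite cardE index_mem mem_enum mem_parallel_classes.
exists (fun l => inord (i l)) => l m lA mA.
rewrite -val_eqE /= !inordK ?i_lt // -(parallel_classP lA mA) /i.
apply/eqP/eqP => [|-> //].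
by apply: (index_inj (parallel_class l)); rewrite mem_enum mem_parallel_classes.
Qed.

Lemma card_noncollinear_ap p :
  #|noncollinear A p| + n.-1 * #|pencil A p| + 1 = n ^ 2.
Proof.
rewrite -(pap_points hA); apply: card_noncollinear => // l lA.
by rewrite A_size // prednK // ltnW.
Qed.

Definition misses (p : T) (C : {set {set T}}) :=
  C \notin [set parallel_class m | m in pencil A p].

Lemma missesP p l m : l \in A -> misses p (parallel_class l) ->
  m \in pencil A p -> ~~ parallel m l.
Proof.
move=> lA pC mp; apply: contra pC => ml; apply/imsetP; exists m => //.
have mA : m \in A by move: mp; rewrite inE => /andP[].
by apply/eqP; rewrite parallel_classP // parallel_sym.
Qed.

Lemma misses_notin p l : l \in A -> misses p (parallel_class l) -> p \notin l.
Proof.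
move=> lA pC; apply/negP => pl.
have lp : l \in pencil A p by rewrite inE lA.
by have := missesP lA pC lp; rewrite parallel_refl.
Qed.

(* The lines through p meet l in distinct points. *)
Lemma card_missed_line p l : l \in A -> misses p (parallel_class l) ->
  n = #|l :&: noncollinear A p| + #|pencil A p|.
Proof.
move=> lA pC; have pl := misses_notin lA pC.
rewrite -{1}(A_size lA) (card_line_noncollinear A_meet lA pl); congr (_ + _).
rewrite -sum1_card; apply: eq_bigr => m mp.
have mA : m \in A by move: mp; rewrite inE => /andP[].
by rewrite nonparallel_meet //; apply: missesP mp.
Qed.

Lemma card_missed_classes p :
  #|parallel_classes| <= #|[set C in parallel_classes | misses p C]| + #|pencil A p|.
Proof.
rewrite -(cardsID [set C | misses p C] parallel_classes); apply: leq_add.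
  by apply: subset_leq_card; apply/subsetP => C; rewrite !inE.
apply: leq_trans (leq_imset_card parallel_class (pencil A p)).
apply: subset_leq_card; apply/subsetP => C; rewrite in_setD inE negbK.
by case/andP.
Qed.

Lemma sum_degree_line l : l \in A ->
  \sum_(p in l) #|pencil A p| + #|parallel_class l| = n + #|A|.
Proof.
move=> lA; rewrite sum_degree.
have -> : #|parallel_class l| = \sum_(m in A) parallel l m.
  rewrite -sum1_card big_mkcond [RHS]big_mkcond /=; apply: eq_bigr => m _.
  by rewrite inE; case: (m \in A); case: parallel.
rewrite -big_split /= (bigD1 l) //= setIid A_size // parallel_refl -addnA.
congr (_ + _); rewrite (cardsD1 l) lA; congr (_ + _).
rewrite -sum1_card; apply: eq_big => [m | m /andP[mA ml]].
  by rewrite !inE andbC.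
case lm: (parallel l m); last by rewrite setIC (nonparallel_meet lA mA) ?lm.
apply/eqP; rewrite addn1 eqSS cards_eq0; move: lm.
by rewrite /parallel eq_sym (negPf ml) setI_eq0 disjoint_sym.
Qed.

Lemma card_cover_class l (B : {set T}) : l \in A ->
  #|B :&: cover (parallel_class l)| = \sum_(m in parallel_class l) #|m :&: B|.
Proof.
move=> lA; rewrite -sum_degree -sum1_card big_mkcond [RHS]big_mkcond /=.
apply: eq_bigr => p _; rewrite inE; case pB: (p \in B) => //=.
case: bigcupP => [[m ml pm] | np].
  apply/esym/eqP/cards1P; exists m; apply/setP => k; rewrite !inE.
  move: ml; rewrite inE => /andP[mA lm].
  apply/andP/eqP => [[/andP[kA lk] pk] | ->]; last by rewrite mA.
  by apply: parallel_meet0 pk pm; have [_ <-] := hpar lA kA mA.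
apply/esym/eqP; rewrite cards_eq0; apply/eqP/setP => k; rewrite !inE.
by apply/negP => /andP[kl pk]; case: np; exists k => //; rewrite inE.
Qed.

Lemma card_class_le l : l \in A -> #|parallel_class l| <= n.
Proof.
move=> lA; have := card_cover_class [set: T] lA.
rewrite (eq_bigr (fun=> n)); last first.
  by move=> m; rewrite inE => /andP[mA _]; rewrite setIT A_size.
rewrite setTI sum_nat_const => h.
have := max_card (mem (cover (parallel_class l))).
by rewrite h (pap_points hA) expnS expn1 leq_pmul2r // ltnW.
Qed.

Lemma card_setC_covers l m : l \in A -> m \in A -> ~~ parallel l m ->
  #|~: cover (parallel_class l) :&: ~: cover (parallel_class m)| =
  (n - #|parallel_class l|) * (n - #|parallel_class m|).
Proof.
move=> lA mA lm.
set U := ~: cover (parallel_class l).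
have cl := card_class_le lA; have cm := card_class_le mA.
have cU : #|U| = n * (n - #|parallel_class l|).
  have := cardsC (cover (parallel_class l)); rewrite -/U (pap_points hA).
  have := card_cover_class [set: T] lA; rewrite setTI => ->.
  rewrite (eq_bigr (fun=> n)); last first.
    by move=> k; rewrite inE => /andP[kA _]; rewrite setIT A_size.
  by rewrite sum_nat_const; move: cl; clear; nia.
have := cardsID (cover (parallel_class m)) U; rewrite card_cover_class //.
rewrite (eq_bigr (fun=> n - #|parallel_class l|)); last first.
  move=> k; rewrite inE => /andP[kA mk].
  have := card_cover_class k lA.
  rewrite (eq_bigr (fun=> 1)); last first.
    move=> l'; rewrite inE => /andP[l'A ll'].
    rewrite nonparallel_meet //; apply: contra lm => l'k.
    have [_ ->] := hpar lA l'A mA => //.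
    by rewrite parallel_sym; have [_ ->] := hpar mA kA l'A => //; rewrite parallel_sym.
  rewrite sum1_card => <-; rewrite -(A_size kA) /U -setDE.
  by rewrite -(cardsID (cover (parallel_class l)) k) addKn.
by rewrite sum_nat_const setDE cU; move: cl cm; clear; nia.
Qed.

Lemma sum_degree_all : \sum_(p in [set: T]) #|pencil A p| = n * #|A|.
Proof.
rewrite sum_degree mulnC -sum_nat_const; apply: eq_bigr => l lA.
by rewrite setIT A_size.
Qed.

Section TooManyClasses.
Hypothesis many : n.+1 < #|parallel_classes|.

Lemma degree_le_order p : #|pencil A p| <= n.
Proof.
have r_le : #|pencil A p| <= n.+1.
  have := card_noncollinear_ap p; move: n_gt1.
  by case: n => // m; case: (leqP #|pencil A p| m.+2) => //; rewrite -mulnn /=; clear; nia.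
have := card_missed_classes p.
case: (set_0Vmem [set C in parallel_classes | misses p C]) => [-> | [C]].
  by rewrite cards0; move: many r_le; clear; lia.
rewrite inE => /andP[/parallel_classesP[l lA ->] pC] _.
by rewrite [leqRHS](card_missed_line lA pC) leq_addl.
Qed.

Lemma card_lines_le_sqr : #|A| <= n ^ 2.
Proof.
have : \sum_(p in [set: T]) #|pencil A p| <= \sum_(p in [set: T]) n.
  by apply: leq_sum => p _; apply: degree_le_order.
rewrite sum_degree_all sum_nat_const cardsT (pap_points hA) mulnC leq_pmul2r //.
exact: ltnW.
Qed.

Lemma card_class_ge l : l \in A -> n <= #|parallel_class l| + (n ^ 2 - #|A|).
Proof.
move=> lA; have := sum_degree_line lA.
have : \sum_(p in l) #|pencil A p| <= \sum_(p in l) n.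
  by apply: leq_sum => p _; apply: degree_le_order.
by rewrite sum_nat_const A_size // mulnn; clear; lia.
Qed.

Lemma not_few_missing_lines : n <= (n ^ 2 - #|A|) ^ 2.
Proof.
have [p rp | r_lt] := pickP (fun p => #|pencil A p| == n); last first.
  have : \sum_(p in [set: T]) #|pencil A p| <= \sum_(p in [set: T]) n.-1.
    apply: leq_sum => p _; have := degree_le_order p; have := r_lt p.
    by clear; lia.
  rewrite sum_degree_all sum_nat_const cardsT (pap_points hA).
  by move: n_gt1; clear; rewrite -!mulnn; nia.
have {}rp := eqP rp.
have /card_gt1P[C [D []]] : 1 < #|[set C in parallel_classes | misses p C]|.
  by have := card_missed_classes p; rewrite rp; move: many; clear; lia.
rewrite !inE => /andP[/parallel_classesP[l lA ->] pl].
move=> /andP[/parallel_classesP[m mA ->] pm]; rewrite parallel_classP // => lm.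
have := card_setC_covers lA mA lm.
have miss k : k \in A -> misses p (parallel_class k) ->
    p |: noncollinear A p \subset ~: cover (parallel_class k).
  move=> kA pk; apply/subsetP => x xp; rewrite inE; apply/bigcupP => -[k' k'k xk'].
  have k'A : k' \in A by move: k'k; rewrite inE => /andP[].
  have pk' : misses p (parallel_class k') by rewrite (parallel_classE kA k'k).
  case/setU1P: xp => [xp | xp].
    by have := misses_notin k'A pk'; rewrite -xp xk'.
  have := card_missed_line k'A pk'; rewrite rp -[LHS]add0n => /addIn /esym /eqP.
  rewrite cards_eq0 => /eqP /setP /(_ x); by rewrite in_setI xk' xp inE.
have := subset_leq_card (introT subsetIP (conj (miss l lA pl) (miss m mA pm))).
have := card_noncollinear_ap p; rewrite cardsU1 rp inE eqxx /=.
have := card_class_ge lA; have := card_class_ge mA.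
move: n_gt1; rewrite -!mulnn => n1 cm cl cN cX cI; rewrite cI in cX.
have nX : n <= (n - #|parallel_class l|) * (n - #|parallel_class m|).
  by apply: leq_trans cX; move: n1 cN; clear; case: n => // k /=; nia.
apply: leq_trans nX _; by apply: leq_mul; rewrite leq_subLR.
Qed.

Lemma sum_missing_class_sizes :
  (n - (n ^ 2 - #|A|)) * (#|parallel_classes| * n - #|A|) <=
  \sum_(l in A) (n - #|parallel_class l|).
Proof.
have pA := partition_parallel_classes.
rewrite (set_partition_big _ pA) /=.
have cA : #|A| = \sum_(C in parallel_classes) #|C| := card_partition pA.
have -> : #|parallel_classes| * n - #|A| = \sum_(C in parallel_classes) (n - #|C|).
  rewrite {1}cA -sum_nat_const -sumnB // => C /parallel_classesP[l lA ->].
  exact: card_class_le.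
rewrite big_distrr /=; apply: leq_sum => C /parallel_classesP[l lA ->].
rewrite (eq_bigr (fun=> n - #|parallel_class l|)); last first.
  by move=> m ml; rewrite (parallel_classE lA ml).
rewrite sum_nat_const leq_mul2r; apply/orP; right.
by rewrite leq_subLR addnC card_class_ge.
Qed.

(* With f = n - degree and s = n^2 - #|A|, the bound f <= s on the covered
   points gives sum f^2 <= s * sum f = n s^2. *)
Lemma not_few_missing_lines_covered :
  (forall x, exists2 l, l \in A & x \in l) ->
  2 * n <= (n ^ 2 - #|A|) ^ 2 + (n ^ 2 - #|A|).
Proof.
move=> covered; set s := n ^ 2 - #|A|.
have bE : #|A| + s = n ^ 2 by rewrite subnKC // card_lines_le_sqr.
pose f p := n - #|pencil A p|.
have fE p : f p + #|pencil A p| = n by rewrite subnK // degree_le_order.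
have f_le p : f p <= s.
  have [l lA pl] := covered p.
  have : \sum_(q in l) (f q + #|pencil A q|) = \sum_(q in l) n.
    by apply: eq_bigr => q _; rewrite fE.
  rewrite big_split /= sum_nat_const A_size // (bigD1 p pl) /=.
  have := sum_degree_line lA; have := card_class_le lA.
  move: bE; rewrite -mulnn; move: (n * n) s (f p) => nn s fp.
  by set X := bigop _ _ _; move: X; set Y := bigop _ _ _; move: Y; clear; lia.
have sum_f : \sum_(p in [set: T]) f p = n * s.
  have : \sum_(p in [set: T]) (f p + #|pencil A p|) = \sum_(p in [set: T]) n.
    by apply: eq_bigr => p _; rewrite fE.
  rewrite big_split /= sum_degree_all sum_nat_const cardsT (pap_points hA).
  by rewrite -bE [RHS]mulnC mulnDr addnC => /addnI.
have sum_r2 : \sum_(p in [set: T]) #|pencil A p| * #|pencil A p| =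
    \sum_(l in A) \sum_(p in l) #|pencil A p|.
  rewrite (exchange_big_dep (mem [set: T])) /=; last by move=> l p; rewrite inE.
  apply: eq_bigr => p _; rewrite -sum_nat_const; apply: eq_bigl => l.
  by rewrite inE.
have sum_k : \sum_(l in A) \sum_(p in l) #|pencil A p| +
    \sum_(l in A) #|parallel_class l| = #|A| * (n + #|A|).
  rewrite -big_split /= -sum_nat_const; apply: eq_bigr => l.
  exact: sum_degree_line.
have sum_d : \sum_(l in A) (n - #|parallel_class l|) +
    \sum_(l in A) #|parallel_class l| = #|A| * n.
  rewrite -big_split /= -sum_nat_const; apply: eq_bigr => l lA.
  by rewrite subnK // card_class_le.
have f2 : \sum_(p in [set: T]) f p * f p <= s * (n * s).
  by rewrite -sum_f big_distrr /=; apply: leq_sum => p _; rewrite leq_mul2r f_le orbT.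
have ffr : \sum_(p in [set: T]) f p * f p + n * (n * #|A|) =
    n * (n * s) + \sum_(p in [set: T]) #|pencil A p| * #|pencil A p|.
  rewrite -sum_f -sum_degree_all !big_distrr -!big_split /=.
  apply: eq_bigr => p _; rewrite -(fE p); move: (f p) #|pencil A p| => a b.
  by clear; lia.
have := sum_missing_class_sizes; rewrite -/s.
have : (n - s) * (n.+2 * n - #|A|) <= (n - s) * (#|parallel_classes| * n - #|A|).
  rewrite leq_mul2l leq_sub2r ?orbT // leq_mul2r; apply/orP; right.
  exact: many.
move=> h1 h2; have {h1 h2} h := leq_trans h1 h2.
have arith (q d k r : nat) : (n - s) * (n.+2 * n - #|A|) <= d ->
    q + n * (n * #|A|) = n * (n * s) + r -> q <= s * (n * s) ->
    d + k = #|A| * n -> r + k = #|A| * (n + #|A|) -> 2 * n <= s ^ 2 + s.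
  move: n_gt1 bE; rewrite -!mulnn; move: #|A| (s); clear.
  move=> b s n1 bs h1 h2 h3 h4 h5.
  have [ns | /ltnW sn] := leqP n s; first by clear -n1 ns; nia.
  have rE : r = b * b + d by move: h4 h5; clear; lia.
  have qE : q = s * s + d.
    have nb : n * (n * b) = b * b + s * b by rewrite mulnA -bs mulnDl.
    have nb' : n * (n * s) = b * s + s * s by rewrite mulnA -bs mulnDl.
    by move: h2; rewrite nb nb' rE; clear; lia.
  have cE : n.+2 * n - b = 2 * n + s by move: bs; clear; nia.
  rewrite cE qE in h1 h3.
  have [u nE] : exists u, n = s + u by exists (n - s); rewrite subnKC.
  have uE : n - s = u by rewrite nE addKn.
  rewrite uE in h1.
  have h : n * (s + 2 * u) <= n * (s * s).
    have E : n * (s + 2 * u) = s * s + u * (2 * n + s) by rewrite nE; clear; lia.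
    by rewrite E; move: h1 h3; clear; lia.
  rewrite leq_pmul2l in h; last exact: ltnW.
  by move: h; rewrite nE; clear; lia.
exact: arith h ffr f2 sum_d (etrans (congr1 (addn^~ _) sum_r2) sum_k).
Qed.

End TooManyClasses.

Theorem card_parallel_classes_le :
  (n ^ 2 - #|A|) ^ 2 < n \/
  (n ^ 2 - #|A| + 1) ^ 2 <= 2 * n /\ (forall x, exists2 l, l \in A & x \in l) ->
  #|parallel_classes| <= n.+1.
Proof.
move=> hs; rewrite leqNgt; apply/negP => many; case: hs => [s_lt | [s_le cov]].
  by have := not_few_missing_lines many; rewrite leqNgt s_lt.
have := not_few_missing_lines_covered many cov.
by move: s_le; move: (n ^ 2 - #|A|) => s; rewrite -!mulnn; clear; lia.
Qed.

End ParallelClasses.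

Import Order.TTheory GRing.Theory Num.Theory.
Local Open Scope ring_scope.

Lemma natrB_lt_sqrt (R : rcfType) (m b c : nat) : (0 < c)%N ->
  m%:R - Num.sqrt c%:R < b%:R :> R -> ((m - b) ^ 2 < c)%N.
Proof.
move=> c0; have [mb _ | /ltnW bm] := leqP m b.
  by rewrite (eqP mb).
rewrite ltrBlDr -ltrBlDl -natrB // => h.
rewrite -(ltr_nat R) natrX -(sqr_sqrtr (ler0n R c)).
by rewrite ltr_pXn2r // nnegrE ?ler0n ?sqrtr_ge0.
Qed.

Lemma natrB_le_sqrt (R : rcfType) (m b c : nat) : (0 < c)%N ->
  m%:R - Num.sqrt c%:R + 1 <= b%:R :> R -> ((m - b + 1) ^ 2 <= c)%N.
Proof.
move=> c0; have [mb _ | /ltnW bm] := leqP m b.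
  by rewrite (eqP mb).
rewrite -lerBrDr lerBlDr -lerBlDl opprB addrA => h.
rewrite -(ler_nat R) natrX -(sqr_sqrtr (ler0n R c)).
rewrite ler_pXn2r ?nnegrE ?ler0n ?sqrtr_ge0 //.
by rewrite natrD natrB // addrAC.
Qed.

Theorem mainTheorem2 (R : rcfType) (n : nat) (T : finType) (A : {set {set T}})
    (hn : (49 <= n)%N)
    (hA : partial_affine_plane n A)
    (hpar : {in A & &, equivalence_rel (@parallel T)})
    (hlines :
      (n%:R ^+ 2 - Num.sqrt n%:R < #|A|%:R :> R) \/
      (n%:R ^+ 2 - Num.sqrt (2 * n%:R) + 1 <= #|A|%:R :> R /\
       forall x : T, exists2 l : {set T}, l \in A & x \in l)) :
  completable n A.
Proof.
have n_gt0 : (0 < n)%N by apply: leq_trans hn.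
have hs : ((n ^ 2 - #|A|) ^ 2 < n)%N \/
    ((n ^ 2 - #|A| + 1) ^ 2 <= 2 * n)%N /\
    (forall x : T, exists2 l : {set T}, l \in A & x \in l).
  case: hlines => [h | [h cov]]; [left | right; split=> //].
    by apply: (@natrB_lt_sqrt R) => //; rewrite natrX.
  apply: (@natrB_le_sqrt R); first by rewrite muln_gt0.
  by rewrite natrX natrM.
have [direction dirP] := exists_direction hpar (card_parallel_classes_le hA hpar hs).
apply: (completable_of_direction hA dirP hn).
case: hs => [|[]//]; move: hn; move: (n ^ 2 - #|A|)%N => s; rewrite -!mulnn; clear.
by nia.
Qed.
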